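(* Let $\alpha>-1$ be a fixed real number different from $-\frac{6}{7}$. The basis functions $\psi_i,\zeta_i$, $i=1,2,3$, of $\mathbb{P}_2(T)$ associated to the finite element $\mathcal{C}_\alpha$ have the following expressions: for $i=1,2,3$, $$\psi_i=c_\alpha\varphi_i+d_\alpha\sum_{\substack{k=1\\k\neq i}}^{3}\varphi_k+\phi_i,\qquad \zeta_i=\frac{1}{\gamma_\alpha L_\alpha}\left((K_\alpha+h_\alpha)\varphi_i-h_\alpha\sum_{\substack{k=1\\k\neq i}}^{3}\varphi_k\right),$$ where $$c_\alpha=\frac{3(11\alpha^2+20\alpha+12)}{(\alpha+6)(7\alpha+6)},\qquad d_\alpha=\frac{3(-3\alpha^2+8\alpha+12)}{(\alpha+6)(7\alpha+6)},\qquad L_\alpha=-\frac{(\alpha+6)(7\alpha+6)}{8(2\alpha+3)^2}.$$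
   Context: Let $T\subset\mathbb{R}^2$ be a nondegenerate triangle with vertices $\boldsymbol{v}_1,\boldsymbol{v}_2,\boldsymbol{v}_3$, with the convention $\boldsymbol{v}_4=\boldsymbol{v}_1$, $\boldsymbol{v}_5=\boldsymbol{v}_2$, and let $\lambda_i$ be the barycentric coordinate associated to $\boldsymbol{v}_i$ (the affine function with $\lambda_i(\boldsymbol{v}_j)=\delta_{ij}$). Let $\mathbb{P}_2(T)$ be the space of real bivariate polynomials of total degree at most $2$, regarded as functions on $T$. Let $\boldsymbol{m}_1=\frac{\boldsymbol{v}_2+\boldsymbol{v}_3}{2}$, $\boldsymbol{m}_2=\frac{\boldsymbol{v}_3+\boldsymbol{v}_1}{2}$, $\boldsymbol{m}_3=\frac{\boldsymbol{v}_1+\boldsymbol{v}_2}{2}$. For $j=1,2,3$ define $$\mathcal{I}^{\mathrm{CR}}_j(f)=\int_0^1 f\left(t\boldsymbol{v}_{j+1}+(1-t)\boldsymbol{v}_{j+2}\right)dt,\qquad \mathcal{F}^{\mathrm{enr}}_{j,\alpha}(f)=\int_0^1 w_\alpha(t)\, f\left(t\boldsymbol{v}_j+(1-t)\boldsymbol{m}_j\right)dt,\qquad w_\alpha(t)=t^\alpha(1-t)^\alpha.$$ The triple $\mathcal{C}_\alpha=(T,\mathbb{P}_2(T),\{\mathcal{I}^{\mathrm{CR}}_j,\mathcal{F}^{\mathrm{enr}}_{j,\alpha}: j=1,2,3\})$ is a finite element (the six functionals are unisolvent on $\mathbb{P}_2(T)$). The basis functions of $\mathbb{P}_2(T)$ associated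 to $\mathcal{C}_\alpha$ are the basis $\{\psi_i,\zeta_i: i=1,2,3\}$ of $\mathbb{P}_2(T)$ satisfying, for $i,j=1,2,3$, $$\mathcal{I}^{\mathrm{CR}}_j(\psi_i)=\delta_{ij},\quad \mathcal{F}^{\mathrm{enr}}_{j,\alpha}(\psi_i)=0,\qquad \mathcal{I}^{\mathrm{CR}}_j(\zeta_i)=0,\quad \mathcal{F}^{\mathrm{enr}}_{j,\alpha}(\zeta_i)=\delta_{ij}.$$ Moreover, $$\varphi_1=\lambda_1(1-3\lambda_2-3\lambda_3),\quad \varphi_2=\lambda_2(1-3\lambda_1-3\lambda_3),\quad \varphi_3=\lambda_3(1-3\lambda_1-3\lambda_2),$$ $$\phi_1=6\lambda_2\lambda_3,\quad \phi_2=6\lambda_1\lambda_3,\quad \phi_3=6\lambda_1\lambda_2,$$ $$\gamma_\alpha=B(\alpha+2,\alpha+1),\qquad h_\alpha=-\frac{5\alpha+6}{4(2\alpha+3)},\qquad K_\alpha=-\frac{\alpha}{2\alpha+3},$$ where $B(z_1,z_2)=\int_0^1 u^{z_1-1}(1-u)^{z_2-1}du$ is the Euler beta function. *)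

(* Defs.v *)
From HB Require Import structures.
From mathcomp Require Import all_boot all_order all_algebra.
From mathcomp Require Import all_classical all_reals all_analysis.

Set Implicit Arguments.
Unset Strict Implicit.
Unset Printing Implicit Defensive.

Import Order.TTheory GRing.Theory Num.Theory.
Import numFieldNormedType.Exports.

Local Open Scope classical_set_scope.
Local Open Scope ring_scope.

(* Vertices are indexed by 'I_3, i.e. 0, 1, 2 stand for 1, 2, 3.  Since 'I_3
   carries the addition modulo 3, i + 1 and i + 2 are the cyclic successors of
   i, which builds in the conventions v_4 = v_1 and v_5 = v_2. *)

Section Triangle.
Context {R : realType}.
Implicit Types (v : 'I_3 -> 'rV[R]_2) (f : 'rV[R]_2 -> R) (i j : 'I_3).

Definition nondegenerate_triangle v : Prop := free [:: v 1 - v 0; v 2 - v 0].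

Definition triangle v : set 'rV[R]_2 :=
  [set x | exists a : 'I_3 -> R,
     [/\ forall i, 0 <= a i, \sum_i a i = 1 & x = \sum_i a i *: v i]].

Definition edge_midpoint v j : 'rV[R]_2 := 2^-1 *: (v (j + 1) + v (j + 2)).

Definition affine_fun f : Prop :=
  exists (g : {scalar 'rV[R]_2}) (c : R), forall x, f x = g x + c.

Definition is_barycentric v (lam : 'I_3 -> 'rV[R]_2 -> R) : Prop :=
  forall i, affine_fun (lam i) /\ forall j, lam i (v j) = (i == j)%:R.

(* An element of P_2(D) is represented by a function on the whole plane of which
   only the restriction to D matters: membership in P_2(D) and equality of
   elements of P_2(D) are both stated on D. *)
Definition P2 (D : set 'rV[R]_2) f : Prop :=
  exists c : nat -> nat -> R, {in D, forall x, f x =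
    \sum_(m < 3) \sum_(n < 3 | (m + n <= 2)%N)
      c m n * x 0 0 ^+ m * x 0 1 ^+ n}.

Definition ICR v j f : R :=
  \int[lebesgue_measure]_(t in `[0, 1])
    f (t *: v (j + 1) + (1 - t) *: v (j + 2)).

Definition weight (alpha t : R) : R := t `^ alpha * (1 - t) `^ alpha.

Definition Fenr v (alpha : R) j f : R :=
  \int[lebesgue_measure]_(t in `[0, 1])
    (weight alpha t * f (t *: v j + (1 - t) *: edge_midpoint v j)).

Definition is_basis_P2 (D : set 'rV[R]_2) (psi zeta : 'I_3 -> 'rV[R]_2 -> R)
    : Prop :=
  let comb (a b : 'I_3 -> R) x :=
    \sum_i a i * psi i x + \sum_i b i * zeta i x in
  [/\ forall i, P2 D (psi i) /\ P2 D (zeta i),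
      forall a b, {in D, forall x, comb a b x = 0} ->
        forall i, a i = 0 /\ b i = 0
    & forall f, P2 D f -> exists a b, {in D, f =1 comb a b}].

Definition is_nodal_basis v (alpha : R) (psi zeta : 'I_3 -> 'rV[R]_2 -> R)
    : Prop :=
  is_basis_P2 (triangle v) psi zeta /\
  forall i j,
    [/\ ICR v j (psi i) = (i == j)%:R,
        Fenr v alpha j (psi i) = 0,
        ICR v j (zeta i) = 0
      & Fenr v alpha j (zeta i) = (i == j)%:R].

Definition varphi (lam : 'I_3 -> 'rV[R]_2 -> R) i (x : 'rV[R]_2) : R :=
  lam i x * (1 - 3 * lam (i + 1) x - 3 * lam (i + 2) x).

Definition phi (lam : 'I_3 -> 'rV[R]_2 -> R) i (x : 'rV[R]_2) : R :=
  6 * lam (i + 1) x * lam (i + 2) x.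

(* The library's beta_fun only takes natural number arguments. *)
Definition Beta (a b : R) : R :=
  \int[lebesgue_measure]_(u in `[0, 1]) (u `^ (a - 1) * (1 - u) `^ (b - 1)).

Definition gamma_ (alpha : R) : R := Beta (alpha + 2) (alpha + 1).

Definition h_ (alpha : R) : R := - ((5 * alpha + 6) / (4 * (2 * alpha + 3))).

Definition K_ (alpha : R) : R := - (alpha / (2 * alpha + 3)).

Definition c_ (alpha : R) : R :=
  3 * (11 * alpha ^+ 2 + 20 * alpha + 12) / ((alpha + 6) * (7 * alpha + 6)).

Definition d_ (alpha : R) : R :=
  3 * (- 3 * alpha ^+ 2 + 8 * alpha + 12) / ((alpha + 6) * (7 * alpha + 6)).

Definition L_ (alpha : R) : R :=
  - ((alpha + 6) * (7 * alpha + 6) / (8 * (2 * alpha + 3) ^+ 2)).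

End Triangle.

(* Main.v *)
(* On T every quadratic polynomial is a combination of the varphi_i and phi_i.
   The edge means vanish on each varphi_i and are dual to the phi_i.  On the
   varphi_i the weighted median functionals act through gamma_alpha times the
   circulant matrix with diagonal K and off-diagonal entries h, whose
   eigenvalues K - h (twice) and K + 2h satisfy L = (K - h)(K + 2h).  For
   alpha > -1 it is thus invertible precisely when alpha <> -6/7, and the stated
   formulas are read off from its inverse.  The moments of w_alpha reduce to
   gamma_alpha because t^(alpha+1) (1-t)^(alpha+1) and t^(alpha+2) (1-t)^(alpha+1)
   vanish at 0 and 1, so that their derivatives have integral 0. *)
Require Import Defs.
From mathcomp Require Import all_boot all_order all_algebra.
From mathcomp Require Import all_classical all_reals all_analysis.
From mathcomp Require Import measurable_realfun ring lra.

Import Order.TTheory GRing.Theory Num.Theory.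
Import numFieldNormedType.Exports.
Local Open Scope classical_set_scope.
Local Open Scope ring_scope.

(** * Fundamental theorem of calculus for integrands unbounded at the endpoints *)

Section FTC.
Context {R : realType}.
Notation mu := (@lebesgue_measure R).
Implicit Types (f F : R -> R) (a b : R).

(** Integrability stands in for continuity at the endpoints, where a negative power blows up. The
    integral function G and F are continuous on [a, b] with the same derivative inside, so G - F is
    constant by the mean value theorem. *)
Lemma integrable_FTC2 f F a b : a < b ->
  mu.-integrable `[a, b] (EFin \o f) ->
  {in `]a, b[, continuous f} ->
  derivable_oo_LRcontinuous F a b ->
  {in `]a, b[, F^`()%classic =1 f} ->
  \int[mu]_(x in `[a, b]) f x = F b - F a.
Proof.
move=> ab intf cf dF F'f.
pose G x := \int[mu]_(t in `[a, x]) f t.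
have cG : {within `[a, b], continuous G}.
  exact: parameterized_integral_continuous (ltW ab) intf.
have cF := derivable_oo_LRcontinuous_within dF.
have [dF1 _ _] := dF.
have dG x : x \in `]a, b[ -> derivable G x 1 /\ G^`()%classic x = f x.
  move=> xab; have /andP[ax xb] : a < x < b by rewrite in_itv in xab.
  by apply: (continuous_FTC1_closed xb) => //; exact: cf.
have dGF x : x \in `]a, b[ -> is_derive x 1 (G - F) 0.
  move=> xab; have [dGx G'x] := dG _ xab.
  have dFx : derivable F x 1 := dF1 x xab.
  apply: DeriveDef; first exact: derivableB dGx dFx.
  by rewrite (deriveB dGx dFx) -!derive1E G'x (F'f x xab) subrr.
have [|c _] := @MVT R (G - F) (cst 0) a b ab dGF.
  by move=> x; apply: cvgB; [exact: cG|exact: cF].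
have Ga : G a = 0 by rewrite /G set_itv1 Rintegral_set1.
rewrite mul0r !fctE Ga -/(G b) => GF; lra.
Qed.

(** On compact intervals exhausting ]a, b[ the integral of f is an increment of F, at most F b - F a
    since F is nondecreasing; monotone convergence carries the bound over to ]a, b[. *)
Lemma ge0_integrable_derive f F a b : a < b ->
  {in `]a, b[, forall x, 0 <= f x} ->
  {in `]a, b[, continuous f} ->
  derivable_oo_LRcontinuous F a b ->
  {in `]a, b[, F^`()%classic =1 f} ->
  mu.-integrable `[a, b] (EFin \o f).
Proof.
move=> ab f0 cf dF F'f.
have mf : measurable_fun `]a, b[ f.
  apply: open_continuous_measurable_fun => //.
  by move=> x; rewrite inE; exact: cf.
(* The factor 1/3 keeps a + e n < b - e n already at n = 0. *)
pose e n : R := (b - a) / 3 / n.+1%:R.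
have e0 n : 0 < e n by rewrite !divr_gt0 ?subr_gt0.
have e_le n : e n <= (b - a) / 3.
  rewrite ler_pdivrMr// ler_peMr ?ler1n// ltW// divr_gt0// subr_gt0//.
pose E n : set R := `[a + e n, b - e n]%classic.
have EE : `]a, b[%classic = \bigcup_n E n.
  apply/seteqP; split => [x /=|x [n _]]; rewrite /E /= !in_itv/=; last first.
    by move=> /andP[h1 h2]; have h := e0 n; apply/andP; split; lra.
  move=> /andP[ax xb].
  (* With d the distance from x to the endpoints, any n with (b - a) / 3 / d < n + 1 puts x in E
     n. *)
  pose d := Num.min (x - a) (b - x).
  have d0 : 0 < d by rewrite lt_min !subr_gt0 ax.
  have e_small : e (Num.truncn ((b - a) / 3 / d)) <= d.
    by rewrite ler_pdivrMr// [d * _]mulrC -ler_pdivrMr// ltW// truncnS_gt.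
  exists (Num.truncn ((b - a) / 3 / d)) => //; rewrite /= in_itv/=.
  move: e_small; rewrite le_min => /andP[h1 h2].
  by apply/andP; split; lra.
have subE n : E n `<=` `]a, b[ by rewrite EE; exact: bigcup_sup.
have mEf n : measurable_fun (E n) (EFin \o f).
  by apply/measurable_EFinP; exact: measurable_funS (subE n) mf.
have cF := derivable_oo_LRcontinuous_within dF.
have [dF1 _ _] := dF.
have F_homo x y : a <= x -> x <= y -> y <= b -> F x <= F y.
  apply: (@ger0_derive1_ndecr _ F a b) => // z zab.
  by rewrite F'f// f0.
have intE n : (\int[mu]_(x in E n) (f x)%:E <= (F b - F a)%:E)%E.
  have := e0 n; have := e_le n => en1 en0.
  rewrite (@continuous_FTC2 _ _ F).
  - rewrite -EFinB lee_fin lerB//; apply: F_homo; lra.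
  - lra.
  - apply: continuous_in_subspaceT => x; rewrite inE => /subE; exact: cf.
  - apply: derivable_oo_continuousW dF; first lra.
    exact: subset_trans (subE n) (@subset_itv_oo_cc _ _ _ _).
  - move=> x xE; apply: F'f; apply: subE.
    exact: subset_itv_oo_cc xE.
apply/integrableP; split.
  apply/measurable_EFinP.
  by apply: measurable_fun_itv_cc mf.
rewrite integral_itv_bndoo; last first.
  by apply: measurableT_comp => //; exact/measurable_EFinP.
have -> : (\int[mu]_(x in `]a, b[) `|(EFin \o f) x| =
           \int[mu]_(x in `]a, b[) (f x)%:E)%E.
  by apply: eq_integral => x; rewrite inE => xab /=; rewrite ger0_norm// f0.
rewrite EE; apply: (@le_lt_trans _ _ (F b - F a)%:E); last exact: ltry.
suff cvgE : (\int[mu]_(x in E n) (f x)%:E)%E @[n --> \oo] -->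
    (\int[mu]_(x in \bigcup_n E n) (f x)%:E)%E.
  by apply: cvge_to_le cvgE _; exact: nearW.
apply: ge0_nondecreasing_set_cvg_integral => //.
- apply/nondecreasing_seqP => n; rewrite subsetEset => x.
  rewrite /E/= !in_itv/=.
  have : e n.+1 <= e n.
    rewrite ler_wpM2l ?lef_pV2 ?posrE ?ler_nat// ltW// divr_gt0// subr_gt0//.
  by move=> h /andP[h1 h2]; apply/andP; split; lra.
- by move=> n; exact: measurable_itv.
- by move=> n x /subE; rewrite lee_fin; exact: f0.
Qed.

End FTC.

(** * Real powers of t and 1 - t up to the endpoints 0 and 1 *)

Section Weight.
Context {R : realType}.
Notation mu := (@lebesgue_measure R).
Implicit Types (p q x alpha : R).

Lemma is_derive_onem_powR p x : x < 1 ->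
  is_derive x 1 (fun t => (1 - t) `^ p) (- (p * (1 - x) `^ (p - 1))).
Proof.
move=> x1; rewrite -[- _]mulrN1.
have dx : is_derive x 1 (fun t : R => 1 - t) (-1).
  by apply: is_derive_eq; ring.
have x1' : 0 < 1 - x by rewrite subr_gt0.
exact: (@is_derive1_comp _ (@powR R ^~ p) (fun t => 1 - t) x _ _
  (is_derive1_powR p x1') dx).
Qed.

(** The limit is written as the value at the endpoint, the form that [derivable_oo_LRcontinuous]
    asks for; likewise below. *)
Lemma cvg_powR_at_right0 p : 0 < p -> x `^ p @[x --> 0^'+] --> (0 : R) `^ p.
Proof. by move=> p0; rewrite powR0 ?gt_eqF//; exact: powR_cvg0. Qed.

Lemma continuous_powR_gt0 p x : 0 < x ->
  {for x, continuous (fun t : R => t `^ p)}.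
Proof.
move=> x0; apply: differentiable_continuous.
by apply/derivable1_diffP/derivable_powR; rewrite in_itv/= x0.
Qed.

Lemma cvg_powR_at_left1 p : x `^ p @[x --> 1^'-] --> (1 : R) `^ p.
Proof. by apply: cvg_at_left_filter; exact: (@continuous_powR_gt0 p 1). Qed.

Lemma cvg_onem_powR_at_right0 p :
  (1 - x) `^ p @[x --> 0^'+] --> ((1 : R) - 0) `^ p.
Proof.
apply: (@decreasing_cvg_at_right_comp _ (fun t : R => 1 - t) (@powR R ^~ p) 0
  (BRight 1)) => //.
- by rewrite bnd_simp.
- by move=> x y _ _ xy; rewrite ltrD2l ltrN2.
- by apply: cvgB; [exact: cvg_cst|exact: cvg_at_right_filter].
- by rewrite subr0; exact: cvg_powR_at_left1.
Qed.

Lemma cvg_onem_powR_at_left1 p : 0 < p ->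
  (1 - x) `^ p @[x --> 1^'-] --> ((1 : R) - 1) `^ p.
Proof.
move=> p0; apply: (@decreasing_cvg_at_left_comp _ (fun t : R => 1 - t)
  (@powR R ^~ p) (BLeft 0)) => //.
- by rewrite bnd_simp.
- by move=> x y _ _ xy; rewrite ltrD2l ltrN2.
- by apply: cvgB; [exact: cvg_cst|exact: cvg_at_left_filter].
- by rewrite subrr; exact: cvg_powR_at_right0.
Qed.

Lemma is_derive_powRM p q x : 0 < x < 1 ->
  is_derive x 1 (fun t => t `^ p * (1 - t) `^ q)
    (p * x `^ (p - 1) * (1 - x) `^ q - q * x `^ p * (1 - x) `^ (q - 1)).
Proof.
move=> /andP[x0 x1].
have d1 := is_derive1_powR p x0; have d2 := is_derive_onem_powR q _ x1.
apply: is_derive_eq; rewrite /GRing.scale/=; ring.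
Qed.

Lemma powRM_LRcontinuous p q : 0 < p -> 0 < q ->
  derivable_oo_LRcontinuous (fun t : R => t `^ p * (1 - t) `^ q) 0 1.
Proof.
move=> p0 q0; split => [x||].
- rewrite in_itv/= => x01; apply: ex_derive.
  exact: is_derive_powRM _ _ _ x01.
- by apply: cvgM; [exact: cvg_powR_at_right0|exact: cvg_onem_powR_at_right0].
- by apply: cvgM; [exact: cvg_powR_at_left1|exact: cvg_onem_powR_at_left1].
Qed.

Lemma continuous_onem_powR_oo p :
  {in `]0, 1[, continuous (fun t : R => (1 - t) `^ p)}.
Proof.
move=> x; rewrite in_itv/= => /andP[x0 x1].
apply: differentiable_continuous; apply/derivable1_diffP.
by apply: ex_derive; exact: is_derive_onem_powR.
Qed.

(** The integrand is the nonnegative derivative of F, which is continuous up to the endpoints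
    because p + 1 > 0. It will dominate the weight, which is unbounded when alpha < 0. *)
Lemma integrable_powRD_onem p : -1 < p ->
  mu.-integrable `[0, 1] (EFin \o (fun t : R => t `^ p + (1 - t) `^ p)).
Proof.
move=> p1; have p0 : 0 < p + 1 by lra.
pose F (t : R) := (t `^ (p + 1) - (1 - t) `^ (p + 1)) * (p + 1)^-1.
have dF x : x \in `]0, 1[ -> is_derive x 1 F (x `^ p + (1 - x) `^ p).
  rewrite in_itv/= => /andP[x0 x1].
  have d1 := is_derive1_powR (p + 1) x0.
  have d2 := is_derive_onem_powR (p + 1) _ x1.
  apply: is_derive_eq; rewrite /GRing.scale/= !addrK; field.
  by rewrite gt_eqF.
apply: (@ge0_integrable_derive _ _ F) => //.
- by move=> x _; rewrite addr_ge0// powR_ge0.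
- move=> x x01; apply: cvgD; last exact: continuous_onem_powR_oo.
  by apply: continuous_powR_gt0; rewrite (itvP x01).
- split => [x /dF dFx||]; first exact: ex_derive.
  + apply: cvgM; last exact: cvg_cst.
    by apply: cvgB; [exact: cvg_powR_at_right0|exact: cvg_onem_powR_at_right0].
  + apply: cvgM; last exact: cvg_cst.
    by apply: cvgB; [exact: cvg_powR_at_left1|exact: cvg_onem_powR_at_left1].
- by move=> x /dF dFx; rewrite derive1E derive_val.
Qed.

(** * Integrability of the weight *)

Lemma measurable_weight alpha (D : set R) : measurable_fun D (weight alpha).
Proof.
apply: measurable_funTS; apply: measurable_funM; first exact: measurable_powR.
suff : measurable_fun setT ((@powR R ^~ alpha) \o (fun t : R => 1 - t)) by [].
by apply: measurableT_comp; [exact: measurable_powR|exact: measurable_funB].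
Qed.

Lemma weight_ge0 alpha x : 0 <= weight alpha x.
Proof. by rewrite mulr_ge0 ?powR_ge0. Qed.

Lemma mulr_powR_le1 p x : -1 < p -> 0 <= x <= 1 -> x * x `^ p <= 1.
Proof.
move=> p1 /andP[x0 x1]; have p0 : 0 < p + 1 by lra.
rewrite -[in x `^ p](addrK 1 p) mulr_powRB1//.
have := @ge0_ler_powR _ _ (ltW p0) x 1.
by rewrite powR1 !nnegrE; exact.
Qed.

Lemma weight_le alpha x : -1 < alpha -> 0 <= x <= 1 ->
  weight alpha x <= x `^ alpha + (1 - x) `^ alpha.
Proof.
move=> a1 x01; have y01 : 0 <= 1 - x <= 1 by lra.
have := mulr_powR_le1 _ _ a1 x01; have := mulr_powR_le1 _ _ a1 y01.
rewrite /weight; have := powR_ge0 x alpha; have := powR_ge0 (1 - x) alpha.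
set u := x `^ _; set w := (1 - x) `^ _ => w0 u0 yw xu.
(* Multiply by 1 = x + (1 - x). *)
have -> : u * w = (x * u) * w + ((1 - x) * w) * u by ring.
by rewrite addrC lerD// ler_piMl.
Qed.

Lemma integrable_weight alpha : -1 < alpha ->
  mu.-integrable `[0, 1] (EFin \o weight alpha).
Proof.
move=> a1; apply: le_integrable (integrable_powRD_onem _ a1) => //.
  by apply/measurable_EFinP; exact: measurable_weight.
move=> x; rewrite /= in_itv/= => x01; rewrite lee_fin.
rewrite !ger0_norm ?weight_ge0 ?addr_ge0 ?powR_ge0//.
exact: weight_le.
Qed.

Lemma integrable_weightX alpha n : -1 < alpha ->
  mu.-integrable `[0, 1] (EFin \o (fun t => weight alpha t * t ^+ n)).
Proof.
move=> a1; apply: le_integrable (integrable_weight _ a1) => //.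
  apply/measurable_EFinP/measurable_funM; first exact: measurable_weight.
  exact: measurable_funX.
move=> x; rewrite /= in_itv/= => /andP[x0 x1]; rewrite lee_fin normrM.
by rewrite ler_piMr// ger0_norm ?exprn_ge0// exprn_ile1.
Qed.

(** * Moments of the weight in terms of gamma_alpha *)

Definition weight_moment alpha n : R :=
  \int[mu]_(t in `[0, 1]) (weight alpha t * t ^+ n).

Lemma Rintegral_weight_poly2 alpha a0 a1 a2 : -1 < alpha ->
  let f t := weight alpha t * (a0 + a1 * t + a2 * t ^+ 2) in
  mu.-integrable `[0, 1] (EFin \o f) /\
  \int[mu]_(t in `[0, 1]) f t =
  a0 * weight_moment alpha 0 + a1 * weight_moment alpha 1
  + a2 * weight_moment alpha 2.
Proof.
move=> al1 f.
have m01 : measurable (`[0, 1]%classic : set (measurableTypeR R)).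
  exact: measurable_itv.
have intw n := integrable_weightX _ n al1.
pose g (c : R) n (t : R) := c * (weight alpha t * t ^+ n).
have intg c n : mu.-integrable `[0, 1] (EFin \o g c n).
  exact: (@integrableZl _ _ _ _ _ m01 c _ (intw n)).
have int01 : mu.-integrable `[0, 1]
    (EFin \o (fun t => g a0 0%N t + g a1 1%N t)).
  exact: (@integrableD _ _ _ _ _ m01 _ _ (intg a0 0%N) (intg a1 1%N)).
have -> : f = fun t => g a0 0%N t + g a1 1%N t + g a2 2%N t.
  by apply/funext => t; rewrite /f /g; ring.
split; first exact: (@integrableD _ _ _ _ _ m01 _ _ int01 (intg a2 2%N)).
rewrite (RintegralD m01 int01 (intg a2 2%N)).
rewrite (RintegralD m01 (intg a0 0%N) (intg a1 1%N)).
by rewrite /g !(RintegralZl _ m01 (intw _)).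
Qed.

(** The integrand u^(alpha+1) (1-u)^alpha of the beta function is u times the weight. *)
Lemma gamma_moment alpha : -1 < alpha -> gamma_ alpha = weight_moment alpha 1.
Proof.
move=> a1; apply: eq_Rintegral => t; rewrite inE/= in_itv/= => /andP[t0 t1].
rewrite addrK (_ : alpha + 2 - 1 = alpha + 1); last ring.
have p0 : 0 < alpha + 1 by lra.
by rewrite -(mulr_powRB1 t0 p0) addrK /weight; ring.
Qed.

Lemma weight_gt0 alpha x : 0 < x < 1 -> 0 < weight alpha x.
Proof. by move=> /andP[x0 x1]; rewrite mulr_gt0// powR_gt0// subr_gt0. Qed.

(** If the nonnegative integrand had integral 0, it would vanish almost everywhere; but it is
    positive on ]0, 1[, a set of measure 1. *)
Lemma gamma_gt0 alpha : -1 < alpha -> 0 < gamma_ alpha.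
Proof.
move=> a1; rewrite gamma_moment//; pose f t : R := weight alpha t * t ^+ 1.
have f0 t : `[0, 1]%classic t -> 0 <= f t.
  by rewrite /= in_itv/= => /andP[t0 _]; rewrite mulr_ge0 ?weight_ge0.
rewrite lt_neqAle Rintegral_ge0// andbT; apply/eqP => /esym int0.
have intf := integrable_weightX _ 1 a1.
have m01 : measurable (`[0, 1]%classic : set (measurableTypeR R)).
  exact: measurable_itv.
have m01' : measurable (`]0, 1[%classic : set (measurableTypeR R)).
  exact: measurable_itv.
have intf0 : (\int[mu]_(t in `[0%R, 1%R]) `|(EFin \o f) t| = 0)%E.
  transitivity (weight_moment alpha 1)%:E; last by rewrite int0.
  rewrite /weight_moment /Rintegral fineK; last first.
    exact: integrable_fin_num intf.
  by apply: eq_integral => t; rewrite inE => /f0 ft; rewrite gee0_abs.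
have [/(_ intf0) aef _] := ae_eq_integral_abs mu m01 (measurable_int mu intf).
have : mu.-negligible (`]0, 1[%classic : set (measurableTypeR R)).
  apply: negligibleS aef => t /= t01 /(_ (subset_itv_oo_cc t01)) [] /eqP.
  rewrite in_itv/= in t01; apply/negP; rewrite gt_eqF// mulr_gt0 ?weight_gt0//.
  by case/andP: t01.
move=> /(negligibleP mu m01') mu0.
have := etrans (esym mu0) (@lebesgue_measure_itv R `]0, 1[).
by rewrite /= lte_fin ltr01 -EFinB subr0 => /eqP; rewrite eqe eq_sym oner_eq0.
Qed.

(** The right-hand side of the hypothesis is the derivative of t^p (1-t)^(alpha+1), which vanishes
    at 0 and 1. Each p making it a weighted quadratic gives a linear relation between moments. *)
Lemma Rintegral_weight_derive alpha p a0 a1 a2 : -1 < alpha -> 0 < p ->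
  (forall t, 0 < t < 1 -> weight alpha t * (a0 + a1 * t + a2 * t ^+ 2) =
    p * t `^ (p - 1) * (1 - t) `^ (alpha + 1)
    - (alpha + 1) * t `^ p * (1 - t) `^ alpha) ->
  a0 * weight_moment alpha 0 + a1 * weight_moment alpha 1
  + a2 * weight_moment alpha 2 = 0.
Proof.
move=> al1 p0 dE; have q0 : 0 < alpha + 1 by lra.
have [intf <-] := Rintegral_weight_poly2 alpha a0 a1 a2 al1.
pose F (t : R) := t `^ p * (1 - t) `^ (alpha + 1).
rewrite (@integrable_FTC2 _ _ F) //.
- rewrite /F subrr !(@powR0 _ (alpha + 1), @powR0 _ p) ?gt_eqF//.
  by rewrite mulr0 mul0r subrr.
- move=> x x01; apply: cvgM.
    apply: cvgM; first by apply: continuous_powR_gt0; rewrite (itvP x01).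
    exact: continuous_onem_powR_oo.
  apply: cvgD; first apply: cvgD; [exact: cvg_cst| |].
    by apply: cvgM; [exact: cvg_cst|exact: cvg_id].
  by apply: cvgM; [exact: cvg_cst|exact: exprn_continuous].
- exact: powRM_LRcontinuous.
- move=> x; rewrite in_itv/= => x01; rewrite dE//.
  have dx := is_derive_powRM p (alpha + 1) x x01.
  by rewrite derive1E derive_val addrK.
Qed.

Lemma weight_moment0 alpha : -1 < alpha ->
  weight_moment alpha 0 = 2 * gamma_ alpha.
Proof.
move=> a1; have p0 : 0 < alpha + 1 by lra.
rewrite gamma_moment//; apply: (mulfI (lt0r_neq0 p0)).
(* With p = alpha + 1 the derivative is the weight times (alpha + 1) (1 - 2 t). *)
have := @Rintegral_weight_derive alpha (alpha + 1) (alpha + 1)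
  (- 2 * (alpha + 1)) 0 a1 p0.
move=> H; apply/eqP; rewrite -subr_eq0 -[X in _ == X]H.
  by apply/eqP; ring.
move=> t /andP[t0 t1]; have t1' : 0 <= 1 - t by lra.
rewrite -!(@mulr_powRB1 _ _ (alpha + 1)) ?(ltW t0)// addrK /weight; ring.
Qed.

Lemma weight_moment2 alpha : -1 < alpha ->
  weight_moment alpha 2 = (alpha + 2) / (2 * alpha + 3) * gamma_ alpha.
Proof.
move=> a1; have p0 : 0 < alpha + 1 by lra.
have q0 : 0 < alpha + 2 by lra.
have r0 : 0 < 2 * alpha + 3 by lra.
rewrite gamma_moment//; apply: (mulfI (lt0r_neq0 r0)).
rewrite [RHS](_ : _ = (alpha + 2) * weight_moment alpha 1); last first.
  by field; rewrite gt_eqF.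
(* With p = alpha + 2 the derivative is the weight times (alpha + 2) t - (2 alpha + 3) t^2. *)
have := @Rintegral_weight_derive alpha (alpha + 2) 0
  (alpha + 2) (- (2 * alpha + 3)) a1 q0.
move=> H; apply/eqP; rewrite eq_sym -subr_eq0 -[X in _ == X]H.
  by apply/eqP; ring.
move=> t /andP[t0 t1]; have t1' : 0 <= 1 - t by lra.
rewrite -(@mulr_powRB1 _ _ (alpha + 2)) ?(ltW t0)//.
rewrite (_ : alpha + 2 - 1 = alpha + 1); last ring.
rewrite -!(@mulr_powRB1 _ _ (alpha + 1)) ?(ltW t0)// addrK /weight; ring.
Qed.

End Weight.

(** * The unweighted case alpha = 0 *)

Lemma weight0 {R : realType} (t : R) : weight 0 t = 1.
Proof. by rewrite /weight !powRr0 mulr1. Qed.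

Lemma weight_moment00 (R : realType) : weight_moment (0 : R) 0 = 1.
Proof.
rewrite /weight_moment.
rewrite (@eq_Rintegral _ _ _ _ _ (cst (1 : R))); last first.
  by move=> t _; rewrite weight0 mulr1.
rewrite Rintegral_cst//= lebesgue_measure_itv/= lte_fin ltr01/=.
by rewrite mul1r subr0.
Qed.

Lemma gamma0 (R : realType) : gamma_ (0 : R) = 2^-1.
Proof.
have := @weight_moment0 R 0; rewrite ltrN10 weight_moment00 => /(_ isT); lra.
Qed.

(* The case alpha = 0 of the weighted moments, as w_0 is constantly 1. *)
Lemma Rintegral_poly2 (R : realType) (a0 a1 a2 : R) :
  \int[lebesgue_measure]_(t in `[0, 1]) (a0 + a1 * t + a2 * t ^+ 2) =
  a0 + a1 / 2 + a2 / 3.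
Proof.
have lt10 : -1 < 0 :> R by rewrite ltrN10.
have [_ intE] := Rintegral_weight_poly2 0 a0 a1 a2 lt10.
transitivity (\int[lebesgue_measure]_(t in `[0, 1])
    (weight 0 t * (a0 + a1 * t + a2 * t ^+ 2))).
  by apply: eq_Rintegral => t _; rewrite weight0 mul1r.
rewrite intE weight_moment2// weight_moment00 -gamma_moment// gamma0.
rewrite mulr0 !add0r.
by field.
Qed.

(** * Cyclic index arithmetic, so that one computation at j serves all three indices *)

Lemma ord3_succ (i : 'I_3) :
  [/\ i + 1 + 1 = i + 2, i + 1 + 2 = i, i + 2 + 1 = i & i + 2 + 2 = i + 1].
Proof. by case: i => [[|[|[|]]]] // i3; split; apply/val_inj. Qed.

Lemma ord3_succ_neq (i : 'I_3) :
  [/\ (i + 1 == i) = false, (i + 2 == i) = false, (i == i + 1) = false,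
      (i == i + 2) = false
    & (i + 1 == i + 2) = false /\ (i + 2 == i + 1) = false].
Proof. by case: i => [[|[|[|]]]]. Qed.

Section Sum3.
Context {V : nmodType}.
Implicit Types (i : 'I_3) (F : 'I_3 -> V).

Lemma sum_ord3D1 i F : \sum_(k < 3 | k != i) F k = F (i + 1) + F (i + 2).
Proof.
have [n1 n2 _ _ [n12 n21]] := ord3_succ_neq i.
rewrite (bigD1 (i + 1)) ?n1//= (bigD1 (i + 2)) ?n2 ?n21//= big1 ?addr0// => k.
by case: i {n1 n2 n12 n21} k => [[|[|[|]]]] // ? [[|[|[|]]]].
Qed.

Lemma sum_ord3 i F : \sum_k F k = F i + F (i + 1) + F (i + 2).
Proof. by rewrite (bigD1 i)//= sum_ord3D1 addrA. Qed.

End Sum3.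

(** * Barycentric coordinates on the triangle *)

Section Triangle.
Context {R : realType}.
Context (v : 'I_3 -> 'rV[R]_2) (lam : 'I_3 -> 'rV[R]_2 -> R).
Context (hlam : is_barycentric v lam).
Implicit Types (f : 'rV[R]_2 -> R) (A B a b : 'I_3 -> R) (i j : 'I_3).

Lemma affine_fun_comb f a : affine_fun f -> \sum_i a i = 1 ->
  f (\sum_i a i *: v i) = \sum_i a i * f (v i).
Proof.
move=> [g [c fE]] a1; rewrite fE linear_sum/= -[c]mul1r -a1.
rewrite mulr_suml -big_split.
by apply: eq_bigr => i _; rewrite fE linearZ/= mulrDr.
Qed.

Lemma bary_comb a i : \sum_i a i = 1 -> lam i (\sum_i a i *: v i) = a i.
Proof.
move=> a1; have [affi lami] := hlam i; rewrite affine_fun_comb//.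
have [_ _ n1 n2 _] := ord3_succ_neq i.
by rewrite (sum_ord3 i) !lami eqxx n1 n2 mulr1 !mulr0 !addr0.
Qed.

Lemma triangle_comb a : (forall i, 0 <= a i) -> \sum_i a i = 1 ->
  \sum_i a i *: v i \in triangle v.
Proof. by move=> a0 a1; rewrite inE; exists a. Qed.

Lemma bary_sum x : x \in triangle v -> \sum_i lam i x = 1.
Proof.
rewrite inE => -[a [a0 a1 ->]]; rewrite -[RHS]a1.
by apply: eq_bigr => i _; rewrite bary_comb.
Qed.

Lemma bary_decomp x : x \in triangle v -> x = \sum_i lam i x *: v i.
Proof.
rewrite inE => -[a [a0 a1 xE]]; rewrite {1}xE.
by apply: eq_bigr => i _; rewrite xE bary_comb.
Qed.

(** Barycentric coordinates are counted cyclically from vertex j: edge j is (0, t, 1 - t) and median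
    j is (t, (1 - t) / 2, (1 - t) / 2). *)
Definition bary_point (p q r : R) (j : 'I_3) : 'rV[R]_2 :=
  p *: v j + q *: v (j + 1) + r *: v (j + 2).

Lemma bary_pointP p q r j : 0 <= p -> 0 <= q -> 0 <= r -> p + q + r = 1 ->
  [/\ bary_point p q r j \in triangle v, lam j (bary_point p q r j) = p,
      lam (j + 1) (bary_point p q r j) = q
    & lam (j + 2) (bary_point p q r j) = r].
Proof.
move=> p0 q0 r0 pqr1.
pose a i := if i == j then p else if i == j + 1 then q else r.
have [n1 n2 _ _ [_ n21]] := ord3_succ_neq j.
have aj : (a j = p) * (a (j + 1) = q) * (a (j + 2) = r).
  by rewrite /a eqxx n1 n2 eqxx n21.
have -> : bary_point p q r j = \sum_i a i *: v i by rewrite (sum_ord3 j) !aj.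
have a1 : \sum_i a i = 1 by rewrite (sum_ord3 j) !aj.
rewrite !bary_comb// !aj; split => //; apply: triangle_comb => // i.
by rewrite /a; case: ifP => // _; case: ifP.
Qed.

(** * Edge and median functionals in the coordinates of varphi_i and phi_i *)

Definition nform A B x :=
  \sum_i A i * varphi lam i x + \sum_i B i * phi lam i x.

(** As the coordinates sum to 1, each varphi_i equals s (3 s - 2) with s its own coordinate. *)
Lemma nform_bary_point A B p q r j : 0 <= p -> 0 <= q -> 0 <= r ->
  p + q + r = 1 ->
  nform A B (bary_point p q r j) =
    A j * (p * (3 * p - 2)) + A (j + 1) * (q * (3 * q - 2))
    + A (j + 2) * (r * (3 * r - 2))
    + 6 * (B j * q * r + B (j + 1) * p * r + B (j + 2) * p * q).
Proof.
move=> p0 q0 r0 pqr1; have [_ lj lj1 lj2] := bary_pointP _ _ _ j p0 q0 r0 pqr1.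
have [e11 e12 e21 e22] := ord3_succ j.
rewrite /nform !(sum_ord3 j) /varphi /phi e11 e12 e21 e22 lj lj1 lj2.
have -> : p = 1 - q - r by lra.
ring.
Qed.

(** On edge j, s (3 s - 2) has integral 0 for s = t and s = 1 - t, and phi_j = 6 t (1 - t) has
    integral 1; the other phi and varphi_j vanish there. *)
Lemma ICR_nform f A B j : {in triangle v, f =1 nform A B} -> ICR v j f = B j.
Proof.
move=> fE; transitivity (\int[lebesgue_measure]_(t in `[0, 1])
    (A (j + 2) + (- (2 * A (j + 1)) - 4 * A (j + 2) + 6 * B j) * t
    + (3 * A (j + 1) + 3 * A (j + 2) - 6 * B j) * t ^+ 2)); last first.
  by rewrite Rintegral_poly2; field.
apply: eq_Rintegral => t; rewrite inE/= in_itv/= => /andP[t0 t1].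
have t1' : 0 <= 1 - t by rewrite subr_ge0.
have s1 : 0 + t + (1 - t) = 1 by ring.
have [xT _ _ _] := bary_pointP _ _ _ j (lexx 0) t0 t1' s1.
have -> : t *: v (j + 1) + (1 - t) *: v (j + 2) = bary_point 0 t (1 - t) j.
  by rewrite /bary_point scale0r add0r.
by rewrite fE// nform_bary_point//; ring.
Qed.

(** Along median j, [K_], [h_] and the two fractions are the weighted integrals, divided by
    gamma_alpha, of varphi_j, either other varphi, phi_j and either other phi. *)
Definition Fenr_nform (alpha : R) A B j : R :=
  gamma_ alpha * (K_ alpha * A j + h_ alpha * (A (j + 1) + A (j + 2))
    + 3 * (alpha + 2) / (2 * (2 * alpha + 3)) * B j
    + 3 * (alpha + 1) / (2 * alpha + 3) * (B (j + 1) + B (j + 2))).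

Lemma Fenr_nformE f (alpha : R) A B j :
  -1 < alpha -> {in triangle v, f =1 nform A B} ->
  Fenr v alpha j f = Fenr_nform alpha A B j.
Proof.
move=> al1 fE; pose As := A (j + 1) + A (j + 2).
pose Bs := B (j + 1) + B (j + 2).
transitivity (\int[lebesgue_measure]_(t in `[0, 1]) (weight alpha t * (
    (3 / 2 * B j - As / 4)
    + (3 * Bs - 3 * B j - 2 * A j - As / 2) * t
    + (3 * A j + 3 / 4 * As + 3 / 2 * B j - 3 * Bs) * t ^+ 2))).
  apply: eq_Rintegral => t; rewrite inE/= in_itv/= => /andP[t0 t1].
  have t1' : 0 <= (1 - t) / 2 by rewrite divr_ge0// subr_ge0.
  have s1 : t + (1 - t) / 2 + (1 - t) / 2 = 1 by field.
  have [xT _ _ _] := bary_pointP _ _ _ j t0 t1' t1' s1.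
  have -> : t *: v j + (1 - t) *: edge_midpoint v j =
      bary_point t ((1 - t) / 2) ((1 - t) / 2) j.
    by rewrite /bary_point /edge_midpoint scalerA scalerDr addrA.
  by rewrite fE// nform_bary_point// /As /Bs; congr (_ * _); field.
have [_ ->] := Rintegral_weight_poly2 alpha (3 / 2 * B j - As / 4)
  (3 * Bs - 3 * B j - 2 * A j - As / 2)
  (3 * A j + 3 / 4 * As + 3 / 2 * B j - 3 * Bs) al1.
rewrite weight_moment0// weight_moment2// -gamma_moment//.
rewrite /Fenr_nform /K_ /h_ /As /Bs; field.
by rewrite gt_eqF//; lra.
Qed.

(** * Spanning of P_2(T) by the varphi_i and phi_i *)

Lemma P2_quadraticP (D : set 'rV[R]_2) f :
  P2 D f <-> exists c0 c1 c2 c3 c4 c5 : R,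
  {in D, forall x, f x = c0 + c1 * x 0 0 + c2 * x 0 1 + c3 * x 0 0 ^+ 2
    + c4 * x 0 0 * x 0 1 + c5 * x 0 1 ^+ 2}.
Proof.
pose poly (c : nat -> nat -> R) (x y : R) := c 0%N 0%N + c 1%N 0%N * x
  + c 0%N 1%N * y + c 2%N 0%N * x ^+ 2 + c 1%N 1%N * x * y + c 0%N 2%N * y ^+ 2.
have polyE (c : nat -> nat -> R) (x y : R) :
    \sum_(m < 3) \sum_(n < 3 | (m + n <= 2)%N) c m n * x ^+ m * y ^+ n =
    poly c x y.
  under eq_bigr do rewrite big_mkcond !big_ord_recl big_ord0 /=.
  rewrite !big_ord_recl big_ord0 /= /bump /= /poly.
  ring.
split=> [[c fE]|[c0 [c1 [c2 [c3 [c4 [c5 fE]]]]]]].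
  exists (c 0 0)%N, (c 1 0)%N, (c 0 1)%N, (c 2 0)%N, (c 1 1)%N, (c 0 2)%N.
  move=> x xD.
  by rewrite fE// polyE.
(* The default branch serves the pair (0, 2); the other pairs it catches have m + n > 2 and do not
   enter the sum. *)
pose c m n := (match m, n with
  | 0, 0 => c0 | 1, 0 => c1 | 0, 1 => c2 | 2, 0 => c3 | 1, 1 => c4 | _, _ => c5
  end)%N.
by exists c => x xD; rewrite fE// polyE.
Qed.

Lemma P2_affineM (D : set 'rV[R]_2) f g : affine_fun f -> affine_fun g ->
  P2 D (fun x => f x * g x).
Proof.
have affE h : affine_fun h -> exists a b c : R,
    forall x, h x = a * x 0 0 + b * x 0 1 + c.
  move=> [l [c hE]]; exists (l (delta_mx 0 0)), (l (delta_mx 0 1)), c => x.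
  rewrite hE [in LHS](row_sum_delta x) linear_sum/= !big_ord_recl big_ord0.
  rewrite addr0 !linearZ/= ![_ * l _]mulrC.
  by congr (l (delta_mx _ _) * x _ _ + l (delta_mx _ _) * x _ _ + _);
    apply/val_inj.
move=> /affE[a [b [c fE]]] /affE[a' [b' [c' gE]]]; apply/P2_quadraticP.
exists (c * c'), (a * c' + a' * c), (b * c' + b' * c), (a * a'),
  (a * b' + a' * b), (b * b') => x _.
by rewrite fE gE; ring.
Qed.

Lemma P2_linear (D : set 'rV[R]_2) f g (k : R) : P2 D f -> P2 D g ->
  P2 D (fun x => k * f x + g x).
Proof.
move=> [c fE] [c' gE]; exists (fun m n => k * c m n + c' m n) => x xD.
rewrite fE// gE// mulr_sumr -big_split; apply: eq_bigr => m _.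
rewrite mulr_sumr -big_split; apply: eq_bigr => n _.
by rewrite /=; ring.
Qed.

Lemma P2_0 (D : set 'rV[R]_2) : P2 D (fun=> 0).
Proof.
exists (fun _ _ => 0) => x _; rewrite big1// => m _.
by rewrite big1// => n _; rewrite !mul0r.
Qed.

Lemma P2_sum (D : set 'rV[R]_2) a (F : 'I_3 -> 'rV[R]_2 -> R) :
  (forall i, P2 D (F i)) -> P2 D (fun x => \sum_i a i * F i x).
Proof.
move=> FP2.
have -> : (fun x => \sum_i a i * F i x) = fun x => a 0 * F 0 x +
    (a (0 + 1) * F (0 + 1) x + (a (0 + 2) * F (0 + 2) x + 0)).
  by apply/funext => x; rewrite (sum_ord3 0); ring.
apply: P2_linear (FP2 _) _; apply: P2_linear (FP2 _) _.
exact: P2_linear (FP2 _) (P2_0 D).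
Qed.

Lemma eq_P2 (D : set 'rV[R]_2) f g : {in D, f =1 g} -> P2 D g -> P2 D f.
Proof. by move=> fg [c gE]; exists c => x xD; rewrite fg// gE. Qed.

(** On the triangle the 1 in varphi_i is the sum of the coordinates, which makes varphi_i a
    combination of products of two affine functions. *)
Lemma P2_varphi i : P2 (triangle v) (varphi lam i).
Proof.
have affM j k : P2 (triangle v) (fun x => lam j x * lam k x).
  by apply: (@P2_affineM _ (lam j) (lam k)); [case: (hlam j)|case: (hlam k)].
apply: (@eq_P2 _ _ (fun x => -2 * (lam i x * lam (i + 1) x) +
  (-2 * (lam i x * lam (i + 2) x) + lam i x * lam i x))).
  move=> x /bary_sum; rewrite /varphi (sum_ord3 i) => xT.
  have -> : lam (i + 2) x = 1 - lam i x - lam (i + 1) x by lra.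
  ring.
exact: P2_linear (affM _ _) (P2_linear _ _ _ _ (affM _ _) (affM _ _)).
Qed.

Lemma P2_phi i : P2 (triangle v) (phi lam i).
Proof.
have affM j k : P2 (triangle v) (fun x => lam j x * lam k x).
  by apply: (@P2_affineM _ (lam j) (lam k)); [case: (hlam j)|case: (hlam k)].
apply: (@eq_P2 _ _ (fun x => 6 * (lam (i + 1) x * lam (i + 2) x) + 0)).
  by move=> x _; rewrite /phi; ring.
exact: P2_linear (affM _ _) (P2_0 _).
Qed.

Lemma nform_P2 f A B : {in triangle v, f =1 nform A B} -> P2 (triangle v) f.
Proof.
move=> fE; apply: (@eq_P2 _ _ (fun x => 1 * (\sum_i A i * varphi lam i x) +
    \sum_i B i * phi lam i x)).
  by move=> x /fE ->; rewrite mul1r.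
by apply: P2_linear; apply: P2_sum; [exact: P2_varphi|exact: P2_phi].
Qed.

Lemma P2_nform f : P2 (triangle v) f ->
  exists A B, {in triangle v, f =1 nform A B}.
Proof.
move=> /P2_quadraticP[c0 [c1 [c2 [c3 [c4 [c5 fE]]]]]].
pose g (x : 'rV[R]_2) := c0 + c1 * x 0 0 + c2 * x 0 1 + c3 * x 0 0 ^+ 2
    + c4 * x 0 0 * x 0 1 + c5 * x 0 1 ^+ 2.
(* The coefficient of phi_i is the mean of g over edge i, which Simpson's rule
   computes exactly. *)
pose simpson i :=
  (g (v (i + 1)) + 4 * g (edge_midpoint v i) + g (v (i + 2))) / 6.
(* At v_i all six functions vanish except varphi_i, which is 1; hence the coefficient g (v i). *)
exists (fun i => g (v i)), simpson => x xT.
rewrite fE//; have := bary_decomp _ xT; have := bary_sum _ xT.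
rewrite (sum_ord3 0) => lam1 xE.
have [e11 e12 e21 e22] := ord3_succ (0 : 'I_3).
rewrite /nform !(sum_ord3 0) /varphi /phi /simpson e11 e12 e21 e22.
have coord k : x 0 k =
    lam 0 x * v 0 0 k + lam (0 + 1) x * v (0 + 1) 0 k +
    lam (0 + 2) x * v (0 + 2) 0 k.
  by rewrite {1}xE (sum_ord3 0) !mxE.
rewrite /g !coord /edge_midpoint !mxE e11 e12 e21 e22.
have -> : lam 0 x = 1 - lam (0 + 1) x - lam (0 + 2) x by lra.
by field.
Qed.

(** * The candidate basis and its duality *)

Context (alpha : R) (al1 : -1 < alpha) (al67 : alpha != - (6 / 7)).

Definition basis_psi i x : R :=
  c_ alpha * varphi lam i x
  + d_ alpha * (\sum_(k < 3 | k != i) varphi lam k x) + phi lam i x.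

Definition basis_zeta i x : R :=
  1 / (gamma_ alpha * L_ alpha) * ((K_ alpha + h_ alpha) * varphi lam i x
    - h_ alpha * (\sum_(k < 3 | k != i) varphi lam k x)).

Definition basis_comb a b x : R :=
  \sum_i a i * basis_psi i x + \sum_i b i * basis_zeta i x.

(** Coefficients of the varphi_i in a combination; those of the phi_i are just a, since phi_i enters
    only psi_i, with coefficient 1. *)
Definition varphi_coef a b i : R :=
  c_ alpha * a i + d_ alpha * (a (i + 1) + a (i + 2))
  + 1 / (gamma_ alpha * L_ alpha) * ((K_ alpha + h_ alpha) * b i
    - h_ alpha * (b (i + 1) + b (i + 2))).

Lemma basis_combE a b : basis_comb a b =1 nform (varphi_coef a b) a.
Proof.
move=> x; have [e11 e12 e21 e22] := ord3_succ (0 : 'I_3).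
rewrite /basis_comb /nform !(sum_ord3 0) /basis_psi /basis_zeta !sum_ord3D1.
by rewrite /varphi_coef e11 e12 e21 e22; ring.
Qed.

(** These factors make up the denominators. The bound alpha > -1 excludes the roots -3/2 and -6 and
    makes gamma_alpha positive; -6/7 is excluded by hypothesis. *)
Lemma alpha_neq0 : [/\ 2 * alpha + 3 != 0, alpha + 6 != 0, 7 * alpha + 6 != 0
  & gamma_ alpha != 0].
Proof.
have a1 := al1.
split; last by rewrite gt_eqF// gamma_gt0.
- by rewrite gt_eqF//; lra.
- by rewrite gt_eqF//; lra.
- by apply: contra al67 => /eqP h; apply/eqP; lra.
Qed.

(** The circulant matrix with diagonal K + h and off-diagonal entries -h is L times the inverse of
    the one with K and h, so the zeta part yields b; [c_] and [d_] make the varphi part of each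
    psi_i cancel the median values of phi_i. *)
Lemma Fenr_nformK a b j : Fenr_nform alpha (varphi_coef a b) a j = b j.
Proof.
have [n1 n2 n3 n4] := alpha_neq0; have [e11 e12 e21 e22] := ord3_succ j.
rewrite /Fenr_nform /varphi_coef e11 e12 e21 e22 /c_ /d_ /K_ /h_ /L_; field.
by rewrite n1 n2 n3 n4.
Qed.

(** The inverse on the other side, which yields spanning: for given B, the median values determine
    A. *)
Lemma varphi_coefK A B i : varphi_coef B (Fenr_nform alpha A B) i = A i.
Proof.
have [n1 n2 n3 n4] := alpha_neq0; have [e11 e12 e21 e22] := ord3_succ i.
rewrite /varphi_coef /Fenr_nform e11 e12 e21 e22 /c_ /d_ /K_ /h_ /L_; field.
by rewrite n1 n2 n3 n4.
Qed.

(** Duality, linear independence and uniqueness all follow from this recovery of the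
    coefficients. *)
Lemma basis_comb_functionals f a b j : {in triangle v, f =1 basis_comb a b} ->
  ICR v j f = a j /\ Fenr v alpha j f = b j.
Proof.
move=> fE; have fN : {in triangle v, f =1 nform (varphi_coef a b) a}.
  by move=> x /fE ->; exact: basis_combE.
by rewrite (ICR_nform _ _ _ _ fN) (Fenr_nformE _ _ _ _ _ al1 fN) Fenr_nformK.
Qed.

Lemma P2_basis_comb f : P2 (triangle v) f <->
  exists a b, {in triangle v, f =1 basis_comb a b}.
Proof.
split=> [/P2_nform[A [B fE]]|[a [b fE]]].
  (* The witnesses are the values of the six functionals at f. *)
  exists B, (Fenr_nform alpha A B) => x xT; rewrite fE// basis_combE /nform.
  by congr (_ + _); apply: eq_bigr => i _; rewrite varphi_coefK.
by apply: nform_P2 => x xT; rewrite fE//; exact: basis_combE.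
Qed.

Lemma sum_delta (F : 'I_3 -> R) i : \sum_k (i == k)%:R * F k = F i.
Proof.
have [_ _ n1 n2 _] := ord3_succ_neq i.
by rewrite (sum_ord3 i) eqxx n1 n2 mul1r !mul0r !addr0.
Qed.

Lemma basis_psi_comb i :
  basis_psi i =1 basis_comb (fun k => (i == k)%:R) (fun=> 0).
Proof.
move=> x; rewrite /basis_comb sum_delta [X in _ + X]big1 ?addr0// => k _.
by rewrite mul0r.
Qed.

Lemma basis_zeta_comb i :
  basis_zeta i =1 basis_comb (fun=> 0) (fun k => (i == k)%:R).
Proof.
move=> x; rewrite /basis_comb sum_delta [X in X + _]big1 ?add0r// => k _.
by rewrite mul0r.
Qed.

(** A nodal function is a combination whose coefficients are its functional values, and duality
    makes these Kronecker deltas. *)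
Lemma nodal_basisP (psi zeta : 'I_3 -> 'rV[R]_2 -> R) :
  is_nodal_basis v alpha psi zeta <->
  forall i, {in triangle v, psi i =1 basis_psi i} /\
            {in triangle v, zeta i =1 basis_zeta i}.
Proof.
split=> [[[P2b _ _] dual] i|formulas].
  have [/P2_basis_comb[a [b psiE]] /P2_basis_comb[a' [b' zetaE]]] := P2b i.
  split=> x xT.
    rewrite psiE// basis_psi_comb; congr basis_comb; apply/funext => j;
    have [Ij Fj] := basis_comb_functionals _ _ _ j psiE;
    by have [] := dual i j; rewrite Ij Fj.
  rewrite zetaE// basis_zeta_comb; congr basis_comb; apply/funext => j;
  have [Ij Fj] := basis_comb_functionals _ _ _ j zetaE;
  by have [_ _] := dual i j; rewrite Ij Fj.
have psiE i : {in triangle v,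
    psi i =1 basis_comb (fun k => (i == k)%:R) (fun=> 0)}.
  by move=> x xT; rewrite (formulas i).1// basis_psi_comb.
have zetaE i : {in triangle v,
    zeta i =1 basis_comb (fun=> 0) (fun k => (i == k)%:R)}.
  by move=> x xT; rewrite (formulas i).2// basis_zeta_comb.
have combE a b : {in triangle v, forall x,
    \sum_i a i * psi i x + \sum_i b i * zeta i x = basis_comb a b x}.
  move=> x xT; congr (_ + _); apply: eq_bigr => i _; congr (_ * _).
    exact: (formulas i).1.
  exact: (formulas i).2.
split; last first.
  move=> i j; have [-> ->] := basis_comb_functionals _ _ _ j (psiE i).
  by have [-> ->] := basis_comb_functionals _ _ _ j (zetaE i).
split=> [i|a b comb0 i|f /P2_basis_comb[a [b fE]]].
- by split; apply/P2_basis_comb; do 2! eexists; [exact: psiE|exact: zetaE].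
(* The zero function has both a, b and 0, 0 as coefficients, and the functionals read off both. *)
- have zero0 : {in triangle v, (fun=> 0) =1 basis_comb (fun=> 0) (fun=> 0)}.
    by move=> x _; rewrite /basis_comb !big1 ?addr0// => k _; rewrite mul0r.
  have zeroab : {in triangle v, (fun=> 0) =1 basis_comb a b}.
    by move=> x xT; rewrite -combE// comb0.
  have [<- <-] := basis_comb_functionals _ _ _ i zeroab.
  exact: basis_comb_functionals zero0.
- by exists a, b => x xT; rewrite fE// combE.
Qed.

End Triangle.

Theorem theorem2p7 (R : realType) (v : 'I_3 -> 'rV[R]_2)
    (lam : 'I_3 -> 'rV[R]_2 -> R) (alpha : R)
    (hv : nondegenerate_triangle v) (hlam : is_barycentric v lam)
    (halpha : -1 < alpha) (halpha' : alpha <> - (6 / 7))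
    (psi zeta : 'I_3 -> 'rV[R]_2 -> R) :
  is_nodal_basis v alpha psi zeta <->
  forall i : 'I_3, {in triangle v, forall x,
    psi i x = c_ alpha * varphi lam i x
              + d_ alpha * (\sum_(k < 3 | k != i) varphi lam k x)
              + phi lam i x
    /\
    zeta i x = 1 / (gamma_ alpha * L_ alpha)
               * ((K_ alpha + h_ alpha) * varphi lam i x
                  - h_ alpha * (\sum_(k < 3 | k != i) varphi lam k x))}.
Proof.
rewrite (nodal_basisP _ _ hlam _ halpha (introN eqP halpha')).
split=> [H i x xT|H i].
  by have [psiE zetaE] := H i; rewrite psiE// zetaE.
by split=> x xT; have [] := H i x xT.
Qed.
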